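(* For all timed causal configurations $\mathcal{P},\mathcal{Q}$ of duration-CSP$_\rho$, every action $a$ and every duration-CSP process $E$: if $\mathcal{P}\sim_{\mathbb{T}}\mathcal{Q}$ then $\rho_{a\to E}(\mathcal{P})\sim_{\mathbb{T}}\rho_{a\to E}(\mathcal{Q})$.
   Context: Duration-CSP processes: $P::=stop\mid skip\{d\}\mid\delta^dP\mid a\{d\};P\mid P+Q\mid P|[L]|Q\mid P\setminus L\mid P\bigtriangleup Q$; each action has a fixed duration $\mathrm{dur}(a)$; $\delta$ is successful termination, $i$ the internal action. Duration-CSP$_\rho$ processes are duration-CSP processes and $\rho_{a\to P}(Q)$ with $P$ a duration-CSP process and $Q$ a duration-CSP$_\rho$ process (refine action $a$ by $P$ in $Q$). Timed causal configurations are built from ${}_{E_\tau}[P]$ ($E_\tau$ a finite set of triples $x{:}a{:}t_x$, $t_x$ the time elapsed since the action $a$ with event $x$ started) by $\delta^d$, $\setminus L$, $+$, $|[L]|$, $\bigtriangleup$, $\rho_{a\to P}(\cdot)$ and the partial sequencing operator $\mathcal{P}\gg^x\mathcal{Q}$, with ${}_{E_\tau}[\rho_{a\to P}(Q)]\equiv\rho_{a\to P}({}_{E_\tau}[Q])$ and event sets distributed over the other operators. $\psi$ (events of a configuration) is $E_\tau$ on ${}_{E_\tau}[\cdot]$ for $stop,skip$, prefix, unchanged through $\delta^d,\setminus L,\rho$, the union for $+,|[L]|,\bigtriangleup$, and $\psi(\mathcal{P}\gg^x\mathcal{Q})=\psi(\mathcal{P})\cup(\psi(\mathcal{Q})\setminus\{x\})$.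 $get$ picks an element from a nonempty set of events; $[y/x]$ renames events; $Finish(E_\tau)$ means $t_x>\mathrm{dur}(a)$ for all $x{:}a{:}t_x\in E_\tau$. The timed transition relation $\leadsto$ (labels ${}_{E_\tau}a_x$ or delays $d$) is given by the duration-CSP rules: ${}_{E_\tau}[stop]\overset{d}{\leadsto}{}_{E_\tau+d}[stop]$ if $\neg Finish(E_\tau)$; when $Finish(E_\tau)$, $skip\{u\}$ performs ${}_{E_\tau}\delta_x$ to ${}_{\{x:\delta:0\}}[stop]$ and can delay while its bound stays $\ge0$, and $a\{u\};P$ performs ${}_{E_\tau}a_x$ to ${}_{\{x:a:0\}}[P]$ ($x=get(\mathcal{E})$) and can delay likewise; choice: an action of either side, delay of both; parallel: delay of both, non-synchronized actions ($\notin L\cup\{\delta\}$) of one side with fresh renaming, synchronized actions ($\in L\cup\{\delta\}$) of both sides merged into ${}_{E_\tau\cup F_\tau}a_z$, $z$ fresh; hiding turns actions in $L$ into $i$; interruption: non-$\delta$ left moves keep the interrupt, a left $\delta$ or any right move discards the other side, delay of both; delay: $\delta^{d+d'}\mathcal{P}\overset{d'}{\leadsto}\delta^d\mathcal{P}$, $\delta^0\mathcal{P}$ moves as $\mathcal{P}$; passage of time ${}_{E_\tau}[P]\overset{d}{\leadsto}{}_{E_\tau+d}[P]$ if $\neg Finish(E_\tau+\epsilon)$ for all $\epsilon\in[0,d]$. Additional rules: (R.1) if $\mathcal{P}\overset{{}_{E_\tau}a_y}{\leadsto}\mathcal{P}'$ then $\mathcal{P}\gg^x\mathcal{Q}\overset{{}_{E_\tau}a_z}{\leadsto}\mathcal{P}'[z/y]\gg^x\mathcal{Q}$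 ($z$ fresh); (R.2) if $\mathcal{P}\overset{{}_{E_\tau}\delta_y}{\leadsto}\mathcal{P}'$ then $\mathcal{P}\gg^x\mathcal{Q}\overset{{}_{E_\tau}i_z}{\leadsto}\mathcal{Q}[z/x]$ ($z$ fresh); (R.3) if $\mathcal{Q}\overset{{}_{E_\tau}a_y}{\leadsto}\mathcal{Q}'$ and $x\notin E_\tau$ then $\mathcal{P}\gg^x\mathcal{Q}\overset{{}_{E_\tau}a_z}{\leadsto}\mathcal{P}\gg^x\mathcal{Q}'[z/y]$ ($z$ fresh, $\ne x$); (R.4) if $\mathcal{Q}\overset{{}_{E_\tau}b_y}{\leadsto}\mathcal{Q}'$ with $b\ne a$ then $\rho_{a\to P}(\mathcal{Q})\overset{{}_{E_\tau}b_x}{\leadsto}\rho_{a\to P}(\mathcal{Q}')$; (R.5) if $\mathcal{Q}\overset{{}_{E_\tau}a_x}{\leadsto}\mathcal{Q}'$ and ${}_{E_\tau}[P]\overset{{}_{E_\tau}b_y}{\leadsto}\mathcal{P}'$ then $\rho_{a\to P}(\mathcal{Q})\overset{{}_{E_\tau}b_z}{\leadsto}\mathcal{P}'[z/y]\gg^x\rho_{a\to P}(\mathcal{Q}')$ ($z$ fresh); (R.$\tau$.1) if $\mathcal{P}\overset{d}{\leadsto}\mathcal{P}'$ and $x\in\psi(\mathcal{Q})$ then $\mathcal{P}\gg^x\mathcal{Q}\overset{d}{\leadsto}\mathcal{P}'\gg^x\mathcal{Q}$; (R.$\tau$.2) if $\mathcal{P}\overset{d}{\leadsto}\mathcal{P}'$,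 $\mathcal{Q}\overset{d}{\leadsto}\mathcal{Q}'$ and $x\notin\psi(\mathcal{Q})$ then $\mathcal{P}\gg^x\mathcal{Q}\overset{d}{\leadsto}\mathcal{P}'\gg^x\mathcal{Q}'$; (R.$\tau$.3) if $\mathcal{Q}\overset{d}{\leadsto}\mathcal{Q}'$ then $\rho_{a\to P}(\mathcal{Q})\overset{d}{\leadsto}\rho_{a\to P}(\mathcal{Q}')$. Timed causal bisimulation $\sim_{\mathbb{T}}$ on configurations: $\mathcal{P}\sim_{\mathbb{T}}\mathcal{Q}$ iff they are related by some relation $\mathfrak{R}$, each pair carrying an event bijection $f$, such that for $(\mathcal{Q}_\tau,\mathcal{P}_\tau)_f\in\mathfrak{R}$: every move $\mathcal{Q}_\tau\overset{{}_{E_\tau}a_x}{\leadsto}\mathcal{Q}'_\tau$ is matched by some $\mathcal{P}_\tau\overset{{}_{F_\tau}a_y}{\leadsto}\mathcal{P}'_\tau$ with ($z{:}b{:}t\in E_\tau$ iff $f(z){:}b{:}t\in F_\tau$) and $(\mathcal{Q}'_\tau,\mathcal{P}'_\tau)_{f'}\in\mathfrak{R}$ where $f'$ is $f$ restricted to domain $\psi(\mathcal{Q}'_\tau)\setminus\{x\}$ and codomain $\psi(\mathcal{P}'_\tau)\setminus\{y\}$, together with $(x,y)$; every delay $\mathcal{Q}_\tau\overset{d}{\leadsto}\mathcal{Q}'_\tau$ is matched by $\mathcal{P}_\tau\overset{d}{\leadsto}\mathcal{P}'_\tau$ with the results related; and symmetrically.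
   Formalization: In the interruption rule, a non-δ left move gets its new event renamed to a fresh one, as in the parallel rule; without this the event picked by get can collide with an event of the interrupting side and the congruence fails. *)

(* Defs.v *)
From mathcomp Require Import all_boot all_order all_algebra.
From mathcomp Require Import finmap interval_inference.

Set Implicit Arguments.
Unset Strict Implicit.
Unset Printing Implicit Defensive.

Import Order.TTheory GRing.Theory Num.Theory.
Local Open Scope fset_scope.
Local Open Scope ring_scope.

(* Time is the nonnegative part of an ordered domain, which covers the usual
   time domains: nonnegative integers, rationals and reals. *)
Notation time R := {nonneg R}.

Section DurationCSP.
Context {R : realDomainType} {act event : choiceType}.

Local Notation T := (time R).

Definition tadd (t d : T) : T := (t%:num + d%:num)%:nng.

Definition tzero : T := 0%:nng.

(* [act] is the set of actions, with the internal action among them;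
   successful termination is not an action and is only met in labels. *)
Local Notation label := (option act).
Definition delta : label := None.

Inductive proc : Type :=
| Stop
| Skip of T
| Delay of T & proc
| Prefix of act & T & proc
| Choice of proc & proc
| Par of proc & pred act & proc
| Hide of proc & pred act
| Interrupt of proc & proc.

Inductive rproc : Type :=
| Base of proc
| Refine of act & proc & rproc.

(* A triple (x, b, t) stands for x:b:t. *)
Definition events : Type := {fset event * label * T}.

(* The event set of a configuration is kept on stop, skip and prefixes only;
   a general E[P] is [conf E P] (or [rconf E P]) below, so that the
   identifications such as E[P + Q] = E[P] + E[Q] hold definitionally. *)
Inductive config : Type :=
| CStop of events
| CSkip of events & T
| CPrefix of events & act & T & proc
| CDelay of T & config
| CChoice of config & config
| CPar of config & pred act & config
| CHide of config & pred act
| CInterrupt of config & config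
| CRefine of act & proc & config
| CSeq of config & event & config.  (* CSeq P x Q is P >>^x Q *)

Fixpoint conf (E : events) (P : proc) : config :=
  match P with
  | Stop => CStop E
  | Skip u => CSkip E u
  | Delay d P => CDelay d (conf E P)
  | Prefix a u P => CPrefix E a u P
  | Choice P Q => CChoice (conf E P) (conf E Q)
  | Par P L Q => CPar (conf E P) L (conf E Q)
  | Hide P L => CHide (conf E P) L
  | Interrupt P Q => CInterrupt (conf E P) (conf E Q)
  end.

Fixpoint rconf (E : events) (P : rproc) : config :=
  match P with
  | Base P => conf E P
  | Refine a P Q => CRefine a P (rconf E Q)
  end.

Definition ev (E : events) : {fset event} := [fset e.1.1 | e in E].

Fixpoint psi (C : config) : {fset event} :=
  match C with
  | CStop E | CSkip E _ | CPrefix E _ _ _ => ev E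
  | CDelay _ C | CHide C _ | CRefine _ _ C => psi C
  | CChoice C D | CPar C _ D | CInterrupt C D => psi C `|` psi D
  | CSeq C x D => psi C `|` (psi D `\ x)
  end.

(* Unlike [psi], this includes the events bound by the sequencing operator. *)
Fixpoint names (C : config) : {fset event} :=
  match C with
  | CStop E | CSkip E _ | CPrefix E _ _ _ => ev E
  | CDelay _ C | CHide C _ | CRefine _ _ C => names C
  | CChoice C D | CPar C _ D | CInterrupt C D => names C `|` names D
  | CSeq C x D => x |` (names C `|` names D)
  end.

Definition fresh (z : event) (s : seq config) : bool :=
  all (fun C => z \notin names C) s.

Definition rename_events (z y : event) (E : events) : events :=
  [fset (if e.1.1 == y then z else e.1.1, e.1.2, e.2) | e in E].

(* C[z/y].  The event x is bound in the right component of [CSeq _ x _]; the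
   transition rules only use a z distinct from all bound events of C, so that
   no capture can occur. *)
Fixpoint rename (z y : event) (C : config) : config :=
  match C with
  | CStop E => CStop (rename_events z y E)
  | CSkip E u => CSkip (rename_events z y E) u
  | CPrefix E a u P => CPrefix (rename_events z y E) a u P
  | CDelay d C => CDelay d (rename z y C)
  | CChoice C D => CChoice (rename z y C) (rename z y D)
  | CPar C L D => CPar (rename z y C) L (rename z y D)
  | CHide C L => CHide (rename z y C) L
  | CInterrupt C D => CInterrupt (rename z y C) (rename z y D)
  | CRefine a P C => CRefine a P (rename z y C)
  | CSeq C x D => CSeq (rename z y C) x (if x == y then D else rename z y D)
  end.

(* E + d *)
Definition age (E : events) (d : T) : events :=
  [fset (e.1.1, e.1.2, tadd e.2 d) | e in E].

(* l \in L, and l \in L \cup {delta} *)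
Definition in_lab (L : pred act) (l : label) : bool :=
  if l is Some a then L a else false.
Definition in_sync (L : pred act) (l : label) : bool :=
  if l is Some a then L a else true.

Definition Finish (dur : label -> T) (E : events) : Prop :=
  forall x b t, (x, b, t) \in E -> (dur b)%:num < t%:num.

(* [astep dur i get C E l x C'] is the transition from C to C' with label l,
   event x and set of causes E; i is the internal action.  The set of all
   events is [fun _ => True]. *)
Inductive astep (dur : label -> T) (i : act) (get : (event -> Prop) -> event) :
  config -> events -> label -> event -> config -> Prop :=
| AS_skip E u x :
    Finish dur E -> x = get (fun _ => True) ->
    astep dur i get (CSkip E u) E delta x (CStop [fset (x, delta, tzero)])
| AS_prefix E a u P x :
    Finish dur E -> x = get (fun _ => True) ->
    astep dur i get (CPrefix E a u P) E (Some a) x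
      (conf [fset (x, Some a, tzero)] P)
| AS_delay0 P E l x P' :
    astep dur i get P E l x P' ->
    astep dur i get (CDelay tzero P) E l x P'
| AS_choice_l P Q E l x P' :
    astep dur i get P E l x P' ->
    astep dur i get (CChoice P Q) E l x P'
| AS_choice_r P Q E l x Q' :
    astep dur i get Q E l x Q' ->
    astep dur i get (CChoice P Q) E l x Q'
| AS_par_l P L Q E l y P' z :
    astep dur i get P E l y P' -> ~~ in_sync L l ->
    fresh z [:: CPar P L Q; P'] ->
    astep dur i get (CPar P L Q) E l z (CPar (rename z y P') L Q)
| AS_par_r P L Q E l y Q' z :
    astep dur i get Q E l y Q' -> ~~ in_sync L l ->
    fresh z [:: CPar P L Q; Q'] ->
    astep dur i get (CPar P L Q) E l z (CPar P L (rename z y Q'))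
| AS_par_sync P L Q E F l x y P' Q' z :
    astep dur i get P E l x P' -> astep dur i get Q F l y Q' -> in_sync L l ->
    fresh z [:: CPar P L Q; P'; Q'] ->
    astep dur i get (CPar P L Q) (E `|` F) l z
      (CPar (rename z x P') L (rename z y Q'))
| AS_hide_out P L E l x P' :
    astep dur i get P E l x P' -> ~~ in_lab L l ->
    astep dur i get (CHide P L) E l x (CHide P' L)
| AS_hide_in P L E l x P' :
    astep dur i get P E l x P' -> in_lab L l ->
    astep dur i get (CHide P L) E (Some i) x (CHide P' L)
| AS_int_l P Q E l y P' z :
    astep dur i get P E l y P' -> l <> delta ->
    (* Q keeps its events, so the new event is renamed as in AS_par_l *)
    fresh z [:: CInterrupt P Q; P'] ->
    astep dur i get (CInterrupt P Q) E l z (CInterrupt (rename z y P') Q)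
| AS_int_delta P Q E x P' :
    astep dur i get P E delta x P' ->
    astep dur i get (CInterrupt P Q) E delta x P'
| AS_int_r P Q E l x Q' :
    astep dur i get Q E l x Q' ->
    astep dur i get (CInterrupt P Q) E l x Q'
| AS_seq_l P x Q E l y P' z :
    astep dur i get P E l y P' ->
    fresh z [:: CSeq P x Q; P'] ->
    astep dur i get (CSeq P x Q) E l z (CSeq (rename z y P') x Q)
| AS_seq_delta P x Q E y P' z :
    astep dur i get P E delta y P' ->
    fresh z [:: CSeq P x Q] ->
    astep dur i get (CSeq P x Q) E (Some i) z (rename z x Q)
| AS_seq_r P x Q E l y Q' z :
    astep dur i get Q E l y Q' -> x \notin ev E ->
    fresh z [:: CSeq P x Q; Q'] ->
    astep dur i get (CSeq P x Q) E l z (CSeq P x (rename z y Q'))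
| AS_ref_other a P Q E l x Q' :
    astep dur i get Q E l x Q' -> l <> Some a ->
    astep dur i get (CRefine a P Q) E l x (CRefine a P Q')
| AS_ref a P Q E l x y P' Q' z :
    astep dur i get Q E (Some a) x Q' ->
    astep dur i get (conf E P) E l y P' ->
    fresh z [:: Q; CSeq P' x Q'] ->
    astep dur i get (CRefine a P Q) E l z
      (CSeq (rename z y P') x (CRefine a P Q')).

Inductive tstep (dur : label -> T) : config -> T -> config -> Prop :=
| TS_stop E d :
    ~ Finish dur E ->
    tstep dur (CStop E) d (CStop (age E d))
| TS_skip E u d :
    Finish dur E ->
    tstep dur (CSkip E (tadd u d)) d (CSkip (age E d) u)
| TS_prefix E a u P d :
    Finish dur E ->
    tstep dur (CPrefix E a (tadd u d) P) d (CPrefix (age E d) a u P)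
| TS_pass E (P : rproc) d :
    (forall e : T, e%:num <= d%:num -> ~ Finish dur (age E e)) ->
    tstep dur (rconf E P) d (rconf (age E d) P)
| TS_delay P d d' :
    tstep dur (CDelay (tadd d d') P) d' (CDelay d P)
| TS_delay0 P d P' :
    tstep dur P d P' ->
    tstep dur (CDelay tzero P) d P'
| TS_choice P Q d P' Q' :
    tstep dur P d P' -> tstep dur Q d Q' ->
    tstep dur (CChoice P Q) d (CChoice P' Q')
| TS_par P L Q d P' Q' :
    tstep dur P d P' -> tstep dur Q d Q' ->
    tstep dur (CPar P L Q) d (CPar P' L Q')
| TS_hide P L d P' :
    tstep dur P d P' ->
    tstep dur (CHide P L) d (CHide P' L)
| TS_int P Q d P' Q' :
    tstep dur P d P' -> tstep dur Q d Q' ->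
    tstep dur (CInterrupt P Q) d (CInterrupt P' Q')
| TS_seq_wait P x Q d P' :
    tstep dur P d P' -> x \in psi Q ->
    tstep dur (CSeq P x Q) d (CSeq P' x Q)
| TS_seq_both P x Q d P' Q' :
    tstep dur P d P' -> tstep dur Q d Q' -> x \notin psi Q ->
    tstep dur (CSeq P x Q) d (CSeq P' x Q')
| TS_ref a P Q d Q' :
    tstep dur Q d Q' ->
    tstep dur (CRefine a P Q) d (CRefine a P Q').

(* Event correspondences are given by their graphs. *)
Definition corr : Type := event -> event -> Prop.

(* f is one-to-one and maps psi C bijectively onto psi D.  Its graph may also
   contain a pair outside of psi C and psi D: by AS_seq_delta, P >>^x Q moves
   with event z to Q[z/x], where z does not occur if x is not in psi Q. *)
Definition event_bijection (f : corr) (C D : config) : Prop :=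
  [/\ forall u v v', f u v -> f u v' -> v = v',
      forall u u' v, f u v -> f u' v -> u = u',
      forall u, u \in psi C -> exists2 v, v \in psi D & f u v
    & forall v, v \in psi D -> exists2 u, u \in psi C & f u v].

Definition same_causes (f : corr) (E F : events) : Prop :=
  forall z w b t, f z w -> ((z, b, t) \in E <-> (w, b, t) \in F).

Definition update (f : corr) (C D : config) (x y : event) : corr :=
  fun u v => [/\ f u v, u \in psi C `\ x & v \in psi D `\ y] \/ (u = x /\ v = y).

Definition bisimulation (dur : label -> T) (i : act)
    (get : (event -> Prop) -> event) (S : config -> config -> corr -> Prop) :
    Prop :=
  forall C D f, S C D f ->
  [/\ event_bijection f C D,
      forall E l x C', astep dur i get C E l x C' ->
        exists F y D', [/\ astep dur i get D F l y D', same_causes f E F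
                         & S C' D' (update f C' D' x y)],
      forall F l y D', astep dur i get D F l y D' ->
        exists E x C', [/\ astep dur i get C E l x C', same_causes f E F
                         & S C' D' (update f C' D' x y)],
      forall d C', tstep dur C d C' ->
        exists2 D', tstep dur D d D' & S C' D' f
    & forall d D', tstep dur D d D' ->
        exists2 C', tstep dur C d C' & S C' D' f].

Definition bisimilar (dur : label -> T) (i : act)
    (get : (event -> Prop) -> event) (C D : config) : Prop :=
  exists (S : config -> config -> corr -> Prop) (f : corr),
    bisimulation dur i get S /\ S C D f.

End DurationCSP.

Arguments proc : clear implicits.
Arguments config : clear implicits.

(* Main.v *)
Require Import Defs.
From mathcomp Require Import all_boot all_order all_algebra.
From mathcomp Require Import finmap interval_inference.

Set Implicit Arguments.
Unset Strict Implicit.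
Unset Printing Implicit Defensive.

(**
  When rho_{a->E}(P) and rho_{a->E}(Q) evolve, they become nested terms
  L1 >>^{x1} (L2 >>^{x2} ... rho_{a->E}(C)) in which the components Li on the two
  sides are copies of the same derivative of E up to a renaming of events, while
  the innermost configurations are bisimilar.  The relation [alpha V] captures
  this: its two sides have the same shape, up to a correspondence of events that
  is extended by a pair of bound events under each sequencing operator, and below
  a refinement operator they may instead be related by V.

  Rule (R.2) renames events inside the innermost configuration, so that V has to
  be stable under renaming.  For V empty, [alpha V] is alpha-equivalence, which is
  a bisimulation; composing with it shows that bisimilarity is stable under
  renaming, and then that [alpha V] is a bisimulation for V bisimilarity.
*)

(** * Correspondences of events *)

Section Correspondences.
Context {event : choiceType}.
Implicit Types (f g h : @corr event) (x y z u v w : event).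

Definition converse f : corr := fun u v => f v u.

Definition one_to_one f : Prop :=
  (forall u v v', f u v -> f u v' -> v = v') /\
  (forall u u' v, f u v -> f u' v -> u = u').

(** Pairs that meet [x] or [y] are shadowed by the new pair, which keeps the correspondence
    one-to-one. The same operation serves for the events bound by sequencing and for the event
    created by a step. *)
Definition bind f x y : corr :=
  fun u v => [/\ f u v, u != x & v != y] \/ (u = x /\ v = y).

Lemma one_to_one_converse f : one_to_one f -> one_to_one (converse f).
Proof. by case=> f1 f2; split=> [u v v'|u u' v]; [apply: f2|apply: f1]. Qed.

Lemma one_to_one_bind f x y : one_to_one f -> one_to_one (bind f x y).
Proof.
case=> f1 f2; split=> [u v v'|u u' v].
  case=> [[fv ux vy]|[-> ->]] [[fv' ux' vy']|[ux' vy']] //.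
  - exact: f1 fv fv'.
  - by rewrite ux' eqxx in ux.
  - by rewrite eqxx in ux'.
case=> [[fv ux vy]|[-> ->]] [[fv' ux' vy']|[ux' vy']] //.
- exact: f2 fv fv'.
- by rewrite vy' eqxx in vy.
- by rewrite eqxx in vy'.
Qed.

Lemma bind_converse f x y u v : bind (converse f) y x v u <-> bind f x y u v.
Proof. by split=> -[[]|[]]; [left|right|left|right]. Qed.

Definition subst z y u : event := if u == y then z else u.

End Correspondences.

Section Refinement.
Local Open Scope fset_scope.
Context {R : realDomainType} {act event : choiceType}.
Local Notation T := (time R).
Local Notation events := (@events R act event).
Local Notation config := (config R act event).
Local Notation corr := (@corr event).
Local Notation indexed_rel := (corr -> config -> config -> Prop).
Implicit Types (E F G : events) (C D M : config) (f g h : corr).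
Implicit Types (x y z u v w : event) (P Q : proc R act) (d : T).

(** * Events of aged and renamed configurations *)

Lemma in_ev E u : reflect (exists b t, (u, b, t) \in E) (u \in ev E).
Proof.
apply: (iffP (imfsetP _ _ _ _)) => [[[[x b] t] /= xE ->]|[b [t uE]]];
  first by exists b, t.
by exists (u, b, t).
Qed.

Lemma in_age E d u b t :
  reflect (exists2 s, (u, b, s) \in E & t = tadd s d) ((u, b, t) \in age E d).
Proof.
apply: (iffP (imfsetP _ _ _ _)) => [[[[x c] s] /= xE [-> -> ->]]|[s sE ->]];
  first by exists s.
by exists (u, b, s).
Qed.

Lemma in_rename_events z y E u b t :
  reflect (exists2 w, (w, b, t) \in E & u = subst z y w)
    ((u, b, t) \in rename_events z y E).
Proof.
apply: (iffP (imfsetP _ _ _ _)) => [[[[x c] s] /= xE [-> -> ->]]|[w wE ->]];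
  first by exists x.
by exists (w, b, t).
Qed.

Lemma ev_age E d : ev (age E d) = ev E.
Proof.
apply/fsetP => u; apply/in_ev/in_ev => [[b [t /in_age[s sE _]]]|[b [t tE]]].
  by exists b, s.
by exists b, (tadd t d); apply/in_age; exists t.
Qed.

Lemma ev_rename_events z y E u :
  reflect (exists2 w, w \in ev E & u = subst z y w) (u \in ev (rename_events z y E)).
Proof.
apply: (iffP (in_ev _ _)) => [[b [t /in_rename_events[w wE ->]]]
  |[w /in_ev[b [t wE]] ->]].
  by exists w => //; apply/in_ev; exists b, t.
by exists b, t; apply/in_rename_events; exists w.
Qed.

Lemma psi_conf E P : psi (conf E P) = ev E.
Proof.
by elim: P => //= [P -> Q ->|P -> L Q ->|P -> Q ->]; rewrite fsetUid.
Qed.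

Lemma psi_names C : psi C `<=` names C.
Proof.
elim: C => //= [C1 IH1 C2 IH2|C1 IH1 L C2 IH2|C1 IH1 C2 IH2|C1 IH1 x C2 IH2];
  try exact: fsetUSS.
apply: fsubset_trans (fsubsetUr _ _); apply: fsetUSS => //.
exact: fsubset_trans (fsubsetDl _ _) IH2.
Qed.

Lemma notin_psi C z : z \notin names C -> z \notin psi C.
Proof. by apply: contra; apply/fsubsetP: z; apply: psi_names. Qed.

(** Only an inclusion, because an event renamed to a [z] that gets captured by a binder disappears
    from [psi]. *)
Lemma psi_rename z y C u :
  u \in psi (rename z y C) -> exists2 w, w \in psi C & u = subst z y w.
Proof.
elim: C u => /= [E|E s|E a s P|s C IH|C1 IH1 C2 IH2|C1 IH1 L C2 IH2|C IH L
  |C1 IH1 C2 IH2|a P C IH|C1 IH1 x C2 IH2] u;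
  try exact: IH; try by move/ev_rename_events.
1-3: by rewrite inE => /orP[/IH1|/IH2] [w wC ->]; exists w; rewrite // inE wC ?orbT.
rewrite !inE => /orP[/IH1[w wC ->]|]; first by exists w; rewrite // !inE wC.
case: (eqVneq x y) => [->|xy] /andP[ux].
  by move=> uC; exists u; rewrite /subst ?(negPf ux) // !inE ux uC orbT.
move/IH2=> [w wC uE]; have [wx|wx] := eqVneq w x.
  by move: ux; rewrite uE wx /subst (negPf xy) eqxx.
by exists w; rewrite // !inE wx wC orbT.
Qed.

(** * Event sets related by a correspondence *)

Definition maps f E F : Prop :=
  forall u b t, (u, b, t) \in E -> exists2 v, f u v & (v, b, t) \in F.

(** Asks each triple to have a partner, whereas [same_causes] constrains all related pairs. This
    form survives an enlargement of [f]. *)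
Definition event_rel f E F : Prop := maps f E F /\ maps (converse f) F E.

Definition covers f (A B : {fset event}) : Prop :=
  (forall u, u \in A -> exists2 v, v \in B & f u v) /\
  (forall v, v \in B -> exists2 u, u \in A & f u v).

Lemma coversU f A A' B B' :
  covers f A B -> covers f A' B' -> covers f (A `|` A') (B `|` B').
Proof.
move=> [a b] [a' b']; split=> w; rewrite inE => /orP[].
- by move=> /a[v vB fv]; exists v; rewrite // inE vB.
- by move=> /a'[v vB fv]; exists v; rewrite // inE vB orbT.
- by move=> /b[v vB fv]; exists v; rewrite // inE vB.
- by move=> /b'[v vB fv]; exists v; rewrite // inE vB orbT.
Qed.

Lemma maps_mono f g E F :
  maps f E F -> (forall u v, u \in ev E -> v \in ev F -> f u v -> g u v) -> maps g E F.
Proof.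
move=> fEF fg u b t uE; have [v fuv vF] := fEF _ _ _ uE.
by exists v => //; apply: fg => //; apply/in_ev; exists b, t.
Qed.

Lemma event_rel_mono f g E F :
  event_rel f E F -> (forall u v, u \in ev E -> v \in ev F -> f u v -> g u v) ->
  event_rel g E F.
Proof.
by case=> fEF fFE fg; split; [apply: maps_mono fEF _|apply: maps_mono fFE _];
  move=> // u v uE vF; apply: fg.
Qed.

Lemma event_rel_covers f E F :
  event_rel f E F -> covers f (ev E) (ev F).
Proof.
move=> [fEF fFE]; split=> [u /in_ev[b [t /fEF[v fuv vF]]]
  |v /in_ev[b [t /fFE[u fuv uE]]]].
  by exists v => //; apply/in_ev; exists b, t.
by exists u => //; apply/in_ev; exists b, t.
Qed.

(** Injectivity leaves a single image for [E]. Hence the copies of [E] distributed over the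
    operators of a process correspond to copies of one event set. *)
Lemma event_rel_fun f E F G :
  one_to_one f -> event_rel f E F -> event_rel f E G -> F = G.
Proof.
move=> [f1 f2] [EF FE] [EG GE]; apply/fsetP => -[[v b] t]; apply/idP/idP.
  by move=> /FE[u fuv /EG[v' fuv']]; rewrite (f1 _ _ _ fuv' fuv).
by move=> /GE[u fuv /EF[v' fuv']]; rewrite (f1 _ _ _ fuv' fuv).
Qed.

Lemma event_relU f E E' F F' :
  event_rel f E F -> event_rel f E' F' -> event_rel f (E `|` E') (F `|` F').
Proof.
move=> [EF FE] [EF' FE']; split=> u b t; rewrite inE => /orP[].
- by move=> /EF[v ? ?]; exists v => //; rewrite inE; apply/orP; left.
- by move=> /EF'[v ? ?]; exists v => //; rewrite inE; apply/orP; right.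
- by move=> /FE[v ? ?]; exists v => //; rewrite inE; apply/orP; left.
- by move=> /FE'[v ? ?]; exists v => //; rewrite inE; apply/orP; right.
Qed.

Lemma maps_age f E F d : maps f E F -> maps f (age E d) (age F d).
Proof.
move=> EF u b t /in_age[s /EF[v fuv vF] ->]; exists v => //.
by apply/in_age; exists s.
Qed.

Lemma event_rel_age f E F d : event_rel f E F -> event_rel f (age E d) (age F d).
Proof. by case=> EF FE; split; apply: maps_age. Qed.

Lemma event_rel1 f x y b t :
  f x y -> event_rel f [fset (x, b, t)] [fset (y, b, t)].
Proof.
by move=> fxy; split=> u c s; rewrite inE => /eqP[-> -> ->];
   [exists y|exists x]; rewrite // inE.
Qed.

Lemma Finish_maps (dur : option act -> T) f E F :
  maps f E F -> Finish dur F -> Finish dur E.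
Proof. by move=> EF fin u b t /EF[v _]; apply: fin. Qed.

Lemma event_rel_rename f f' z y E F :
  event_rel f E F ->
  (forall u v, u \in ev E -> v \in ev F -> f u v -> f' (subst z y u) v) ->
  event_rel f' (rename_events z y E) F.
Proof.
move=> [EF FE] ff'; split=> [u b t /in_rename_events[w wE ->]|v b t vF].
  have [v fwv vF] := EF _ _ _ wE; exists v => //.
  by apply: ff' => //; apply/in_ev; exists b, t.
have [u fuv uE] := FE _ _ _ vF; exists (subst z y u).
  by apply: ff' => //; apply/in_ev; exists b, t.
by apply/in_rename_events; exists u.
Qed.

(** * The relation [alpha V]: monotonicity, symmetry, renaming *)

Definition flip (V : indexed_rel) f C D : Prop := V (converse f) D C.

(* The disjunction in the case of [CRefine] lets [V] relate configurations that
   need not have the same shape. *)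
Fixpoint alpha (V : indexed_rel) f C D : Prop :=
  match C, D with
  | CStop E, CStop F => event_rel f E F
  | CSkip E s, CSkip F t => s = t /\ event_rel f E F
  | CPrefix E a s P, CPrefix F b t Q => [/\ a = b, s = t, P = Q & event_rel f E F]
  | CDelay s C, CDelay t D => s = t /\ alpha V f C D
  | CChoice C1 C2, CChoice D1 D2 => alpha V f C1 D1 /\ alpha V f C2 D2
  | CPar C1 L C2, CPar D1 L' D2 => [/\ L = L', alpha V f C1 D1 & alpha V f C2 D2]
  | CHide C L, CHide D L' => L = L' /\ alpha V f C D
  | CInterrupt C1 C2, CInterrupt D1 D2 => alpha V f C1 D1 /\ alpha V f C2 D2
  | CRefine a P C, CRefine b Q D => [/\ a = b, P = Q & alpha V f C D \/ V f C D]
  | CSeq C1 x C2, CSeq D1 y D2 => alpha V f C1 D1 /\ alpha V (bind f x y) C2 D2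
  | _, _ => False
  end.

(** Besides enlarging [f], this allows pairs outside of [psi C] and [psi D] to be dropped. *)
Definition monotone (V : indexed_rel) : Prop :=
  forall f g C D, V f C D ->
  (forall u v, u \in psi C -> v \in psi D -> f u v -> g u v) -> V g C D.

Definition renaming_closed (V : indexed_rel) : Prop :=
  forall f g C D z y, V f C D -> z \notin names C ->
  (forall u v, u \in psi C -> v \in psi D -> f u v -> g (subst z y u) v) ->
  V g (rename z y C) D.

Lemma monotone_flip V : monotone V -> monotone (flip V).
Proof. by move=> mV f g C D fCD fg; apply: mV fCD _ => u v uD vC; apply: fg. Qed.

Lemma alpha_mono V : monotone V -> monotone (alpha V).
Proof.
move=> mV f g C; elim: C f g => [E|E s|E a s P|s C IH|C1 IH1 C2 IH2|C1 IH1 L C2 IH2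
  |C IH L|C1 IH1 C2 IH2|a P C IH|C1 IH1 x C2 IH2] f g.
- by case=> //= F EF fg; apply: event_rel_mono EF fg.
- by case=> //= F t [-> EF] fg; split=> //; apply: event_rel_mono EF fg.
- by case=> //= F b t Q [-> -> -> EF] fg; split=> //; apply: event_rel_mono EF fg.
- by case=> //= t D [-> CD] fg; split=> //; apply: IH CD fg.
- case=> //= D1 D2 [CD1 CD2] fg; split; [apply: IH1 CD1 _|apply: IH2 CD2 _];
  by move=> u v uC vD; apply: fg; rewrite inE ?uC ?vD ?orbT.
- case=> //= D1 L' D2 [-> CD1 CD2] fg; split=> //; [apply: IH1 CD1 _|apply: IH2 CD2 _];
  by move=> u v uC vD; apply: fg; rewrite inE ?uC ?vD ?orbT.
- by case=> //= D L' [-> CD] fg; split=> //; apply: IH CD fg.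
- case=> //= D1 D2 [CD1 CD2] fg; split; [apply: IH1 CD1 _|apply: IH2 CD2 _];
  by move=> u v uC vD; apply: fg; rewrite inE ?uC ?vD ?orbT.
- case=> //= b Q D [-> -> CD] fg; split=> //.
  by case: CD => CD; [left; apply: IH CD fg|right; apply: mV CD fg].
- case=> //= D1 y D2 [CD1 CD2] fg; split; [apply: IH1 CD1 _|apply: IH2 CD2 _].
    by move=> u v uC vD; apply: fg; rewrite inE ?uC ?vD ?orbT.
  move=> u v uC vD [[fuv ux vy]|]; last by right.
  by left; split=> //; apply: fg; rewrite // !inE ?ux ?vy ?uC ?vD ?orbT.
Qed.

(** Under a binder, [converse] commutes with [bind] only up to pointwise equivalence, and
    monotonicity bridges this gap. *)
Lemma alpha_flip V f C D : monotone V -> alpha V (converse f) D C -> alpha (flip V) f C D.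
Proof.
move=> mV; elim: C f D => [E|E s|E a s P|s C IH|C1 IH1 C2 IH2|C1 IH1 L C2 IH2
  |C IH L|C1 IH1 C2 IH2|a P C IH|C1 IH1 x C2 IH2] f.
- by case=> //= F [].
- by case=> //= F t [-> []].
- by case=> //= F b t Q [-> -> -> []].
- by case=> //= t D [-> /IH].
- by case=> //= D1 D2 [/IH1 ? /IH2].
- by case=> //= D1 L' D2 [-> /IH1 ? /IH2].
- by case=> //= D L' [-> /IH].
- by case=> //= D1 D2 [/IH1 ? /IH2].
- by case=> //= b Q D [-> -> [/IH|]]; split=> //; [left|right].
- case=> //= D1 y D2 [/IH1 ? CD2]; split=> //; apply: IH2.
  by apply: alpha_mono CD2 _ => // u v _ _ /bind_converse.
Qed.

Lemma alpha_rename V : monotone V -> renaming_closed V -> renaming_closed (alpha V).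
Proof.
move=> mV rV f g C D z y; elim: C f g D => [E|E s|E a s P|s C IH|C1 IH1 C2 IH2
  |C1 IH1 L C2 IH2|C IH L|C1 IH1 C2 IH2|a P C IH|C1 IH1 x C2 IH2] f g.
- by case=> //= F EF _ fg; apply: event_rel_rename EF fg.
- by case=> //= F t [-> EF] _ fg; split=> //; apply: event_rel_rename EF fg.
- by case=> //= F b t Q [-> -> -> EF] _ fg; split=> //; apply: event_rel_rename EF fg.
- by case=> //= t D [-> CD] zC fg; split=> //; apply: IH CD zC fg.
- case=> //= D1 D2 [CD1 CD2]; rewrite inE negb_or => /andP[z1 z2] fg.
  split; [apply: IH1 CD1 z1 _|apply: IH2 CD2 z2 _];
  by move=> u v uC vD; apply: fg; rewrite inE ?uC ?vD ?orbT.
- case=> //= D1 L' D2 [-> CD1 CD2]; rewrite inE negb_or => /andP[z1 z2] fg.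
  split=> //; [apply: IH1 CD1 z1 _|apply: IH2 CD2 z2 _];
  by move=> u v uC vD; apply: fg; rewrite inE ?uC ?vD ?orbT.
- by case=> //= D L' [-> CD] zC fg; split=> //; apply: IH CD zC fg.
- case=> //= D1 D2 [CD1 CD2]; rewrite inE negb_or => /andP[z1 z2] fg.
  split; [apply: IH1 CD1 z1 _|apply: IH2 CD2 z2 _];
  by move=> u v uC vD; apply: fg; rewrite inE ?uC ?vD ?orbT.
- case=> //= b Q D [-> -> CD] zC fg; split=> //.
  by case: CD => CD; [left; apply: IH CD zC fg|right; apply: rV CD zC fg].
- case=> //= D1 x' D2 [CD1 CD2]; rewrite !inE !negb_or => /and3P[zx z1 z2] fg.
  split; first by apply: IH1 CD1 z1 _ => u v uC vD; apply: fg; rewrite inE ?uC ?vD.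
  (* If [x = y], the renaming stops at this binder, and [subst] fixes every event other than [x]. *)
  case: eqVneq => [xy|xy].
    apply: alpha_mono CD2 _ => // u v uC vD [[fuv ux vx']|]; last by right.
    left; split=> //; have := fg u v; rewrite /subst -xy (negPf ux).
    by apply; rewrite // !inE ?ux ?vx' ?uC ?vD orbT.
  apply: IH2 CD2 z2 _ => u v uC vD [[fuv ux vx']|[-> ->]]; last first.
    by right; rewrite /subst (negPf xy).
  (* The renamed event differs from the bound [x], since freshness of [z] gives [z != x]. *)
  left; split=> //; last by rewrite /subst; case: ifP.
  by apply: fg; rewrite // !inE ?ux ?vx' ?uC ?vD orbT.
Qed.

(** * Renaming on both sides and extension by fresh pairs *)

Definition equivariant (V : indexed_rel) : Prop :=
  [/\ monotone V, renaming_closed V & renaming_closed (flip V)].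

Lemma equivariant_flip V : equivariant V -> equivariant (flip V).
Proof. by case=> mV rV rV'; split=> //; apply: monotone_flip. Qed.

Lemma alpha_unflip V f C D : monotone V -> alpha (flip V) f C D -> alpha V (converse f) D C.
Proof. by move=> mV CD; apply: (@alpha_flip (flip V)) => //; apply: monotone_flip. Qed.

Lemma equivariant_alpha V : equivariant V -> equivariant (alpha V).
Proof.
case=> mV rV rV'; split; [exact: alpha_mono|exact: alpha_rename|].
move=> f g C D z y CD zC fg; apply: alpha_unflip => //.
have mV' := monotone_flip mV.
by apply: alpha_rename zC fg => //; apply: alpha_flip.
Qed.

Lemma equivariant_rename2 V f g C D z y z' y' : equivariant V ->
  V f C D -> z \notin names C -> z' \notin names D ->
  (forall u v, u \in psi C -> v \in psi D -> f u v ->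
    g (subst z y u) (subst z' y' v)) ->
  V g (rename z y C) (rename z' y' D).
Proof.
case=> mV rV rV' CD zC z'D fg.
(* The least correspondence that permits the renaming on the left; it remembers [u], so that the
   renaming on the right can still use the pair of [f]. *)
pose k : corr := fun w v => exists2 u, u \in psi C & f u v /\ w = subst z y u.
have kCD : V k (rename z y C) D.
  by apply: rV CD zC _ => u v uC vD fuv; exists u.
apply: (rV' (converse k) (converse g) D (rename z y C) z' y' kCD z'D).
move=> v w vD wC [u uC [fuv ->]].
exact: fg.
Qed.

(** For rules that replace the event of a premise by a fresh one, and for the end of a sequencing,
    where a bound event becomes free. *)
Lemma equivariant_bind_rename V f C D z y z' y' : equivariant V ->
  V (bind f y y') C D -> z \notin names C -> z' \notin names D ->
  V (bind f z z') (rename z y C) (rename z' y' D).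
Proof.
move=> cV CD zC z'D; apply: (equivariant_rename2 cV CD zC z'D) => u v uC vD.
case=> [[fuv uy vy']|[-> ->]]; last by right; rewrite /subst !eqxx.
left; rewrite /subst (negPf uy) (negPf vy'); split=> //.
  by apply: contraTN uC => /eqP ->; apply: notin_psi.
by apply: contraTN vD => /eqP ->; apply: notin_psi.
Qed.

(** A step under a binder adds its pair in the scope of the bound pair [(x, x')], but afterwards the
    pair belongs outside. The two extensions commute because [z != x] and [z' != x']. *)
Lemma equivariant_bind2_rename V f C D x x' z y z' y' : equivariant V ->
  V (bind (bind f x x') y y') C D -> z \notin names C -> z' \notin names D ->
  z != x -> z' != x' ->
  V (bind (bind f z z') x x') (rename z y C) (rename z' y' D).
Proof.
move=> cV CD zC z'D zx zx'; apply: (equivariant_rename2 cV CD zC z'D) => u v uC vD.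
case=> [[fuv uy vy']|[-> ->]]; last first.
  by rewrite /subst !eqxx; left; split=> //; right.
rewrite /subst (negPf uy) (negPf vy').
case: fuv => [[fuv ux vx']|]; last by right.
left; split=> //; left; split=> //.
  by apply: contraTN uC => /eqP ->; apply: notin_psi.
by apply: contraTN vD => /eqP ->; apply: notin_psi.
Qed.

Lemma equivariant_bind_fresh V f C D z z' : equivariant V ->
  V f C D -> z \notin names C -> z' \notin names D -> V (bind f z z') C D.
Proof.
case=> mV _ _ CD zC z'D; apply: mV CD _ => u v uC vD fuv; left; split=> //.
  by apply: contraTN uC => /eqP ->; apply: notin_psi.
by apply: contraTN vD => /eqP ->; apply: notin_psi.
Qed.

Lemma equivariant_bind2_fresh V f C D x x' z z' : equivariant V ->
  V (bind f x x') C D -> z \notin names C -> z' \notin names D ->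
  V (bind (bind f z z') x x') C D.
Proof.
case=> mV _ _ CD zC z'D; apply: mV CD _ => u v uC vD [[fuv ux vx]|]; last by right.
left; split=> //; left; split=> //.
  by apply: contraTN uC => /eqP ->; apply: notin_psi.
by apply: contraTN vD => /eqP ->; apply: notin_psi.
Qed.

(** * Free events under [alpha V], and configurations of processes *)

Lemma alpha_covers V f C D :
  (forall f C D, one_to_one f -> V f C D -> covers f (psi C) (psi D)) ->
  one_to_one f -> alpha V f C D -> covers f (psi C) (psi D).
Proof.
move=> cV; elim: C f D => [E|E s|E a s P|s C IH|C1 IH1 C2 IH2|C1 IH1 L C2 IH2
  |C IH L|C1 IH1 C2 IH2|a P C IH|C1 IH1 x C2 IH2] f D f11; case: D => //=.
- by move=> F /event_rel_covers.
- by move=> F t [_ /event_rel_covers].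
- by move=> F b t Q [_ _ _ /event_rel_covers].
- by move=> t D [_ /(IH _ _ f11)].
- by move=> D1 D2 [/(IH1 _ _ f11) ? /(IH2 _ _ f11)]; apply: coversU.
- by move=> D1 L' D2 [_ /(IH1 _ _ f11) ? /(IH2 _ _ f11)]; apply: coversU.
- by move=> D L' [_ /(IH _ _ f11)].
- by move=> D1 D2 [/(IH1 _ _ f11) ? /(IH2 _ _ f11)]; apply: coversU.
- by move=> b Q D [_ _ [/(IH _ _ f11)|/(cV _ _ _ f11)]].
- move=> D1 y D2 [/(IH1 _ _ f11) c1 /(IH2 _ _ (one_to_one_bind x y f11))[a2 b2]].
  apply: coversU c1 _.
  split=> w; rewrite !inE.
    move=> /andP[wx /a2[v vD]] [[fwv _ vy]|[wE]]; last by rewrite wE eqxx in wx.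
    by exists v; rewrite // !inE vy vD.
  move=> /andP[wx /b2[v vD]] [[fwv vy _]|[_ wE]]; last by rewrite wE eqxx in wx.
  by exists v; rewrite // !inE vy vD.
Qed.

Lemma alpha_conf V f E F P : event_rel f E F -> alpha V f (conf E P) (conf F P).
Proof. by move=> EF; elim: P. Qed.

(** Needed for the passage of time, whose rule applies only to a process over a single event set.
    Branching operators yield two sets [F] and [F'], which [event_rel_fun] identifies. *)
Lemma alpha_confP V f E P D : one_to_one f ->
  alpha V f (conf E P) D -> exists2 F, D = conf F P & event_rel f E F.
Proof.
move=> f11; elim: P D => [|s|s P IH|a s P IH|P1 IH1 P2 IH2|P1 IH1 L P2 IH2|P IH L
  |P1 IH1 P2 IH2].
- by case=> //= F EF; exists F.
- by case=> //= F t [-> EF]; exists F.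
- by case=> //= t D [-> /IH[F -> EF]]; exists F.
- by case=> //= F b t Q [-> -> -> EF]; exists F.
- case=> //= D1 D2 [/IH1[F -> EF] /IH2[F' -> EF']].
  by exists F => //; rewrite (event_rel_fun f11 EF' EF).
- case=> //= D1 L' D2 [-> /IH1[F -> EF] /IH2[F' -> EF']].
  by exists F => //; rewrite (event_rel_fun f11 EF' EF).
- by case=> //= D L' [-> /IH[F -> EF]]; exists F.
- case=> //= D1 D2 [/IH1[F -> EF] /IH2[F' -> EF']].
  by exists F => //; rewrite (event_rel_fun f11 EF' EF).
Qed.

Lemma alpha_refl V C : monotone V -> alpha V eq C C.
Proof.
move=> mV; have e E : event_rel eq E E by split=> u b t ?; exists u.
elim: C => //= [a P C IH|C1 IH1 x C2 IH2]; first by split=> //; left.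
split=> //; apply: alpha_mono IH2 _ => // u v _ _ ->.
by have [->|vx] := eqVneq v x; [right|left].
Qed.

(** * Simulations indexed by correspondences *)

Variant action_match dur i get V f E l x (C' D : config) : Prop :=
  ActionMatch F y D' of @astep R act event dur i get D F l y D' &
    event_rel f E F & V (bind f x y) C' D' : action_match dur i get V f E l x C' D.

(** One direction of a bisimulation. Actions extend [f] by [bind], which unlike [update] does not
    restrict it to the events of the results; a monotone relation does not see the difference. *)
Definition simulation dur i get (V : indexed_rel) : Prop :=
  forall f C D, one_to_one f -> V f C D ->
  [/\ covers f (psi C) (psi D),
      forall E l x C', astep dur i get C E l x C' ->
        action_match dur i get V f E l x C' D
    & forall d C', tstep dur C d C' -> exists2 D', tstep dur D d D' & V f C' D'].

(** * Fresh events, and free events along transitions *)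

Section Steps.
Context (dur : option act -> T) (i : act) (get : (event -> Prop) -> event).
Context (event_infinite : forall s : seq event, exists x, x \notin s).

Lemma fresh_exists (s : seq config) : exists z, fresh z s.
Proof.
have [z zs] := event_infinite (flatten [seq enum_fset (names C) | C <- s]).
exists z; elim: s zs => //= C s IH; rewrite mem_cat negb_or => /andP[zC /IH zs].
by apply/andP.
Qed.

Lemma psi_rconf E (P : @rproc R act) : psi (rconf E P) = ev E.
Proof. by elim: P => //= P; apply: psi_conf. Qed.

(** Delays change elapsed times only, so a correspondence is carried across them as it is. *)
Lemma tstep_psi C d C' : tstep dur C d C' -> psi C' = psi C.
Proof.
elim=> {C d C'} //=; try by move=> *; rewrite ev_age.
- by move=> E P d _; rewrite !psi_rconf ev_age.
- by move=> P Q d P' Q' _ -> _ ->.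
- by move=> P L Q d P' Q' _ -> _ ->.
- by move=> P Q d P' Q' _ -> _ ->.
- by move=> P x Q d P' _ ->.
- by move=> P x Q d P' Q' _ -> _ ->.
Qed.

(** Lets conditions stated on the events of the source be used for the causes and the target of a
    step. *)
Lemma astep_psi C E l x C' : astep dur i get C E l x C' ->
  ev E `<=` psi C /\ psi C' `<=` x |` psi C.
Proof.
have ren a b D A : psi D `<=` b |` A -> psi (rename a b D) `<=` a |` A.
  move=> /fsubsetP DA; apply/fsubsetP => u /psi_rename[w /DA + ->].
  by rewrite /subst !inE; case: eqVneq => [_ _|_ /= ->]; rewrite ?eqxx ?orbT.
have ev1 y (b : option act) (t : T) : ev [fset (y, b, t)] = [fset y].
  apply/fsetP => u; rewrite inE; apply/in_ev/eqP => [[c [s]]|->].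
    by rewrite inE => /eqP[].
  by exists b, t; rewrite inE.
have sub z (A B B' : {fset event}) : A `<=` z |` B -> B `<=` B' -> A `<=` z |` B'.
  by move=> AB BB; apply: fsubset_trans AB _; apply: fsetUS.
elim=> {C E l x C'} //=.
- by move=> E u x _ _; rewrite ev1 fsubset_refl fsubsetUl.
- by move=> E a u P x _ _; rewrite psi_conf ev1 fsubset_refl fsubsetUl.
- move=> P Q E l x P' _ [EP PP]; split; first exact: fsubset_trans EP (fsubsetUl _ _).
  by apply: sub PP _; apply: fsubsetUl.
- move=> P Q E l x P' _ [EP PP]; split; first exact: fsubset_trans EP (fsubsetUr _ _).
  by apply: sub PP _; apply: fsubsetUr.
- move=> P L Q E l y P' z _ [EP PP] _ _.
  split; first exact: fsubset_trans EP (fsubsetUl _ _).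
  by rewrite fsetUA; apply: fsetUSS => //; apply: ren PP.
- move=> P L Q E l y P' z _ [EP PP] _ _.
  split; first exact: fsubset_trans EP (fsubsetUr _ _).
  by rewrite fsetUCA; apply: fsetUSS => //; apply: ren PP.
- move=> P L Q E F l x y P' Q' z _ [EP PP] _ [EQ QQ] _ _.
  split; first by rewrite /ev imfsetU; apply: fsetUSS.
  rewrite fsubUset; apply/andP; split.
    by apply: sub (ren _ _ _ _ PP) _; apply: fsubsetUl.
  by apply: sub (ren _ _ _ _ QQ) _; apply: fsubsetUr.
- move=> P Q E l y P' z _ [EP PP] _ _.
  split; first exact: fsubset_trans EP (fsubsetUl _ _).
  by rewrite fsetUA; apply: fsetUSS => //; apply: ren PP.
- move=> P Q E x P' _ [EP PP]; split; first exact: fsubset_trans EP (fsubsetUl _ _).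
  by apply: sub PP _; apply: fsubsetUl.
- move=> P Q E l x P' _ [EP PP]; split; first exact: fsubset_trans EP (fsubsetUr _ _).
  by apply: sub PP _; apply: fsubsetUr.
- move=> P x Q E l y P' z _ [EP PP] _.
  split; first exact: fsubset_trans EP (fsubsetUl _ _).
  by rewrite fsetUA; apply: fsetUSS => //; apply: ren PP.
- move=> P x Q E y P' z _ [EP PP] _.
  split; first exact: fsubset_trans EP (fsubsetUl _ _).
  apply: sub (fsubsetUr _ _); apply: ren.
  by apply/fsubsetP => u uQ; rewrite !inE uQ andbT orbN.
(* The bound [x] may occur in [psi Q]; the side condition of the rule keeps it out of the causes. *)
- move=> P x Q E l y Q' z _ [/fsubsetP EQ QQ] xE _; split.
    apply/fsubsetP => u uE; rewrite !inE (EQ _ uE) andbT orbC.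
    by case: eqVneq => // ux; rewrite -ux uE in xE.
  rewrite fsetUCA; apply: fsetUS; apply/fsubsetP => u; rewrite !inE => /andP[ux].
  move=> /(fsubsetP (ren _ _ _ _ QQ)); rewrite !inE ux; exact.
(* Apart from [y], the events of [P'] are causes of the refined action, hence in [psi Q]; the event
   [x] becomes bound. *)
- move=> a P Q E l x y P' Q' z _ [EQ QQ] _ [_]; rewrite psi_conf => PP _.
  split=> //; rewrite fsubUset; apply/andP; split; first by apply: sub (ren _ _ _ _ PP) _.
  apply/fsubsetP => u; rewrite !inE => /andP[ux] /(fsubsetP QQ).
  by rewrite !inE (negPf ux) /= => ->; rewrite orbT.
Qed.

(** * [alpha V] simulates delays and actions *)

(** The other side may lose the shape [rconf F P] below a refinement where [V] takes over. One
    descends through the refinements until either a process is reached or [V] answers the same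
    passage of time. *)
Lemma alpha_pass V f E (P : @rproc R act) d D :
  simulation dur i get V -> one_to_one f -> alpha V f (rconf E P) D ->
  (forall e : T, (e%:num <= d%:num)%R -> ~ Finish dur (age E e)) ->
  exists2 D', tstep dur D d D' & alpha V f (rconf (age E d) P) D'.
Proof.
move=> simV f11 + live; elim: P D => [P|a P Q IH] D /=.
  move=> /(alpha_confP f11)[F -> EF]; exists (conf (age F d) P).
    apply: (@TS_pass _ _ _ dur F (Base P)) => e ed.
    move=> /(Finish_maps (event_rel_age e EF).1); exact: live.
  by apply: alpha_conf; apply: event_rel_age.
case: D => //= b P' D [<- <- [/IH|QD]].
  by case=> D' DD' QD'; exists (CRefine a P D'); [apply: TS_ref|split=> //; left].
have [_ _ /(_ d _ (TS_pass Q live))[D' DD' QD']] := simV _ _ _ f11 QD.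
by exists (CRefine a P D'); [apply: TS_ref|split=> //; right].
Qed.

Lemma alpha_tstep V f C d C' D :
  simulation dur i get V -> one_to_one f -> tstep dur C d C' -> alpha V f C D ->
  exists2 D', tstep dur D d D' & alpha V f C' D'.
Proof.
move=> simV f11 st.
(* Both sides must use the same one of the two delay rules for sequencing, which are told apart by
   the occurrence of the bound event. *)
have seq_bound g x y D1 D2 : one_to_one g -> alpha V (bind g x y) D1 D2 ->
    (x \in psi D1) = (y \in psi D2).
  move=> g11 /alpha_covers; case=> [h C0 D0 h11 CD0||Q1 Q2].
  - by have [] := simV _ _ _ h11 CD0.
  - exact: one_to_one_bind.
  - apply/idP/idP => [/Q1[v vQ] [[]|[_ <-]]|/Q2[u uQ] [[]|[<- _]]] //;
    by rewrite eqxx.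
elim: st f f11 D => {C d C'}.
- move=> E d live f f11 [] //= F EF; exists (CStop (age F d)).
    by apply: TS_stop => /(Finish_maps EF.1).
  exact: event_rel_age.
- move=> E u d fin f f11 [] //= F _ [<- EF]; exists (CSkip (age F d) u).
    by apply: TS_skip; apply: Finish_maps EF.2 fin.
  by split=> //; apply: event_rel_age.
- move=> E a u P d fin f f11 [] //= F _ _ _ [<- <- <- EF].
  exists (CPrefix (age F d) a u P).
    by apply: TS_prefix; apply: Finish_maps EF.2 fin.
  by split=> //; apply: event_rel_age.
- by move=> E P d live f f11 D ED; apply: alpha_pass.
- move=> P d d' f f11 [] //= _ D [<- PD]; exists (CDelay d D) => //.
  exact: TS_delay.
- move=> P d P' _ IH f f11 [] //= _ D [<- /(IH _ f11)[D' ? ?]].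
  by exists D' => //; apply: TS_delay0.
- move=> P Q d P' Q' _ IHP _ IHQ f f11 [] //= D1 D2.
  by case=> /(IHP _ f11)[D1' ? ?] /(IHQ _ f11)[D2' ? ?];
    exists (CChoice D1' D2') => //; apply: TS_choice.
- move=> P L Q d P' Q' _ IHP _ IHQ f f11 [] //= D1 L' D2.
  by case=> <- /(IHP _ f11)[D1' ? ?] /(IHQ _ f11)[D2' ? ?];
    exists (CPar D1' L D2') => //; apply: TS_par.
- move=> P L d P' _ IH f f11 [] //= D _ [<- /(IH _ f11)[D' ? ?]].
  by exists (CHide D' L) => //; apply: TS_hide.
- move=> P Q d P' Q' _ IHP _ IHQ f f11 [] //= D1 D2.
  by case=> /(IHP _ f11)[D1' ? ?] /(IHQ _ f11)[D2' ? ?];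
    exists (CInterrupt D1' D2') => //; apply: TS_int.
- move=> P x Q d P' _ IH xQ f f11 [] //= D1 y D2.
  case=> /(IH _ f11)[D1' ? ?] QD; exists (CSeq D1' y D2) => //.
  apply: TS_seq_wait => //.
  by rewrite -(seq_bound _ _ _ _ _ f11 QD).
- move=> P x Q d P' Q' _ IHP _ IHQ xQ f f11 [] //= D1 y D2 [PD QD].
  have [D1' ? ?] := IHP _ f11 _ PD.
  have [D2' ? ?] := IHQ _ (one_to_one_bind x y f11) _ QD.
  exists (CSeq D1' y D2') => //.
  by apply: TS_seq_both => //; rewrite -(seq_bound _ _ _ _ _ f11 QD).
- move=> a P Q d Q' st IH f f11 [] //= b P' D [<- <- [/(IH _ f11)|QD]].
    by case=> D' DD' QD'; exists (CRefine a P D'); [apply: TS_ref|split=> //; left].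
  have [_ _ /(_ d _ st)[D' DD' QD']] := simV _ _ _ f11 QD.
  by exists (CRefine a P D'); [apply: TS_ref|split=> //; right].
Qed.

(** Each rule is answered by the same rule, with a fresh event chosen separately for the other side
    where the rule demands one; below a refinement [V] may supply the answer. *)
Lemma alpha_astep V f C E l x C' D : equivariant V -> simulation dur i get V ->
  one_to_one f -> astep dur i get C E l x C' -> alpha V f C D ->
  action_match dur i get (alpha V) f E l x C' D.
Proof.
move=> cV simV f11 st; have cr := equivariant_alpha cV; have [mr _ _] := cr.
elim: st f f11 D => {C E l x C'}.
- move=> E u x fin xE f f11 [] //= F _ [<- EF].
  (* Both sides take the event that [get] picks from all events, so the new pair is [(x, x)]. *)
  have finF := Finish_maps EF.2 fin.
  apply: ActionMatch (AS_skip _ _ finF xE) EF _.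
  by apply: event_rel1; right.
- move=> E a u P x fin xE f f11 [] //= F _ _ _ [<- <- <- EF].
  have finF := Finish_maps EF.2 fin.
  apply: ActionMatch (AS_prefix _ _ _ _ finF xE) EF _.
  by apply/alpha_conf/event_rel1; right.
- move=> P E l x P' _ IH f f11 [] //= _ D [<- /(IH _ f11)[F y D' DD' EF PD']].
  by apply: ActionMatch EF PD'; apply: AS_delay0.
- move=> P Q E l x P' _ IH f f11 [] //= D1 D2 [/(IH _ f11)[F y D' DD' EF PD'] _].
  by apply: ActionMatch EF PD'; apply: AS_choice_l.
- move=> P Q E l x P' _ IH f f11 [] //= D1 D2 [_ /(IH _ f11)[F y D' DD' EF PD']].
  by apply: ActionMatch EF PD'; apply: AS_choice_r.
- move=> P L Q E l y P' z _ IH lL zC f f11 [] //= D1 _ D2 [<- + QD].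
  move=> /(IH _ f11)[F y' D' DD' EF PD'].
  have [z' z'D] := fresh_exists [:: CPar D1 L D2; D'].
  apply: ActionMatch (AS_par_l DD' lL z'D) EF _ => /=.
  move: zC z'D; rewrite /= !inE !negb_or.
  move=> /and3P[/andP[zP zQ] zP' _] /and3P[/andP[zD1 zD2] zD' _].
  by split=> //; [apply: equivariant_bind_rename PD' _ _|apply: equivariant_bind_fresh].
- move=> P L Q E l y Q' z _ IH lL zC f f11 [] //= D1 _ D2 [<- PD].
  move=> /(IH _ f11)[F y' D' DD' EF QD'].
  have [z' z'D] := fresh_exists [:: CPar D1 L D2; D'].
  apply: ActionMatch (AS_par_r DD' lL z'D) EF _ => /=.
  move: zC z'D; rewrite /= !inE !negb_or.
  move=> /and3P[/andP[zP zQ] zP' _] /and3P[/andP[zD1 zD2] zD' _].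
  by split=> //; [apply: equivariant_bind_fresh|apply: equivariant_bind_rename QD' _ _].
- move=> P L Q E E' l x y P' Q' z _ IHP _ IHQ lL zC f f11 [] //= D1 _ D2 [<-].
  move=> /(IHP _ f11)[F x' D1' DD1 EF PD] /(IHQ _ f11)[F' y' D2' DD2 EF' QD].
  have [z' z'D] := fresh_exists [:: CPar D1 L D2; D1'; D2'].
  apply: ActionMatch (AS_par_sync DD1 DD2 lL z'D) (event_relU EF EF') _ => /=.
  move: zC z'D => /and4P[_ zP zQ _] /and4P[_ zD1 zD2 _].
  by split=> //;
    [apply: equivariant_bind_rename PD _ _|apply: equivariant_bind_rename QD _ _].
- move=> P L E l x P' _ IH lL f f11 [] //= D _ [<- /(IH _ f11)[F y D' DD' EF PD']].
  by apply: ActionMatch (AS_hide_out DD' lL) EF _.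
- move=> P L E l x P' _ IH lL f f11 [] //= D _ [<- /(IH _ f11)[F y D' DD' EF PD']].
  by apply: ActionMatch (AS_hide_in DD' lL) EF _.
- move=> P Q E l y P' z _ IH lL zC f f11 [] //= D1 D2 [+ QD].
  move=> /(IH _ f11)[F y' D' DD' EF PD'].
  have [z' z'D] := fresh_exists [:: CInterrupt D1 D2; D'].
  apply: ActionMatch (AS_int_l DD' lL z'D) EF _ => /=.
  move: zC z'D; rewrite /= !inE !negb_or.
  move=> /and3P[/andP[zP zQ] zP' _] /and3P[/andP[zD1 zD2] zD' _].
  by split=> //; [apply: equivariant_bind_rename PD' _ _|apply: equivariant_bind_fresh].
- move=> P Q E x P' _ IH f f11 [] //= D1 D2 [/(IH _ f11)[F y D' DD' EF PD'] _].
  by apply: ActionMatch EF PD'; apply: AS_int_delta.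
- move=> P Q E l x P' _ IH f f11 [] //= D1 D2 [_ /(IH _ f11)[F y D' DD' EF PD']].
  by apply: ActionMatch EF PD'; apply: AS_int_r.
- move=> P x Q E l y P' z _ IH zC f f11 [] //= D1 x' D2 [+ QD].
  move=> /(IH _ f11)[F y' D' DD' EF PD'].
  have [z' z'D] := fresh_exists [:: CSeq D1 x' D2; D'].
  apply: ActionMatch (AS_seq_l DD' z'D) EF _ => /=.
  move: zC z'D; rewrite /= !inE !negb_or.
  move=> /and3P[/and3P[zx zP zQ] zP' _] /and3P[/and3P[zx' zD1 zD2] zD' _].
  by split=> //; [apply: equivariant_bind_rename PD' _ _|apply: equivariant_bind2_fresh].
- move=> P x Q E y P' z _ IH zC f f11 [] //= D1 x' D2 [+ QD].
  move=> /(IH _ f11)[F y' D' DD' EF PD'].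
  have [z' z'D] := fresh_exists [:: CSeq D1 x' D2].
  apply: ActionMatch (AS_seq_delta DD' z'D) EF _ => /=.
  move: zC z'D; rewrite /= !inE !negb_or !andbT.
  move=> /and3P[zx zP zQ] /and3P[zx' zD1 zD2].
  (* The bound pair [(x, x')] is turned into the free pair [(z, z')]. *)
  exact: equivariant_bind_rename QD _ _.
- move=> P x Q E l y Q' z _ IH xE zC f f11 [] //= D1 x' D2 [PD].
  move=> /(IH _ (one_to_one_bind x x' f11))[F y' D' DD' EF QD'].
  have [z' z'D] := fresh_exists [:: CSeq D1 x' D2; D'].
  (* Under [bind f x x'] the only partner of [x'] is [x], which is not a cause. *)
  have x'F : x' \notin ev F.
    apply: contra xE => /(event_rel_covers EF).2[u uE [[_ _]|[<- _]]] //.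
    by rewrite eqxx.
  apply: ActionMatch (AS_seq_r DD' x'F z'D) _ _ => /=.
    (* As [x] is not a cause, the pair [(x, x')] never occurs here, and [f] alone relates the
       causes. *)
    apply: event_rel_mono EF _ => u v uE _ [[]|[ux _]] //.
    by rewrite -ux uE in xE.
  move: zC z'D; rewrite /= !inE !negb_or.
  move=> /and3P[/and3P[zx zP zQ] zP' _] /and3P[/and3P[zx' zD1 zD2] zD' _].
  by split=> //; [apply: equivariant_bind_fresh|apply: equivariant_bind2_rename QD' _ _ _ _].
- move=> a P Q E l x Q' st IH la f f11 [] //= b P1 D [<- <- [/(IH _ f11)|QD]].
    case=> F y D' DD' EF QD'; apply: ActionMatch (AS_ref_other _ DD' la) EF _.
    by split=> //; left.
  have [_ /(_ _ _ _ _ st)[F y D' DD' EF QD'] _] := simV _ _ _ f11 QD.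
  apply: ActionMatch (AS_ref_other _ DD' la) EF _.
  by split=> //; right.
- move=> a P Q E l x y P' Q' z stQ IHQ _ IHP zC f f11 [] //= b P1 D [<- <- QD].
  (* Answers the action to be refined, whether the bodies are related by [alpha V] or by [V]. *)
  have [F x' D' DD' EF QD'] : action_match dur i get
      (fun g C D => alpha V g C D \/ V g C D) f E (Some a) x Q' D.
    case: QD => [/(IHQ _ f11)|QD].
      by case=> F y' D' DD' EF QD'; apply: ActionMatch DD' EF _; left.
    have [_ /(_ _ _ _ _ stQ)[F y' D' DD' EF QD'] _] := simV _ _ _ f11 QD.
    by apply: ActionMatch DD' EF _; right.
  have [F1 y' P1' PP1 EF1 PP1'] := IHP _ f11 _ (alpha_conf V P EF).
  (* The refinement rule wants the first step of [P] to have exactly the causes [F] of the refined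
     action. *)
  rewrite -(event_rel_fun f11 EF EF1) in PP1.
  have [z' z'D] := fresh_exists [:: D; CSeq P1' x' D'].
  apply: ActionMatch (AS_ref DD' PP1 z'D) EF _ => /=.
  move: zC z'D; rewrite /= !inE !negb_or.
  move=> /and3P[zQ /and3P[zx zP' zQ'] _] /and3P[zD /and3P[zx' zP1' zD'] _].
  split=> //; first exact: equivariant_bind_rename PP1' _ _.
  by split=> //; case: QD' => ?; [left|right]; apply: equivariant_bind2_fresh.
Qed.

(** * Two-sided simulations and their composition *)

Definition bisimulating V : Prop :=
  simulation dur i get V /\ simulation dur i get (flip V).

Lemma bisimulating_flip V : bisimulating V -> bisimulating (flip V).
Proof. by case. Qed.

(** Stands in for extensionality: [flip] passes through [alpha] and [comp] only up to
    equivalence. *)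
Lemma eq_simulation V W : (forall f C D, V f C D <-> W f C D) ->
  simulation dur i get V -> simulation dur i get W.
Proof.
move=> VW simV f C D f11 /VW /(simV _ _ _ f11)[cov act_V time_V]; split=> //.
  move=> E l x C' /act_V[F y D' DD' EF /VW CD'].
  exact: ActionMatch DD' EF CD'.
by move=> d C' /time_V[D' DD' /VW CD']; exists D'.
Qed.

Lemma simulation_alpha V : equivariant V ->
  simulation dur i get V -> simulation dur i get (alpha V).
Proof.
move=> eV simV f C D f11 CD; split.
- by apply: alpha_covers CD => // g C0 D0 g11 /(simV _ _ _ g11)[].
- by move=> E l x C' CC'; apply: alpha_astep CC' CD.
- by move=> d C' CC'; apply: alpha_tstep CC' CD.
Qed.

Lemma bisimulating_alpha V :
  equivariant V -> bisimulating V -> bisimulating (alpha V).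
Proof.
move=> eV [simV simV']; split; first exact: simulation_alpha.
have [mV _ _] := eV.
apply: eq_simulation (simulation_alpha (equivariant_flip eV) simV') => f C D.
by split; [apply: alpha_unflip|apply: alpha_flip].
Qed.

Lemma covers_mono f g A B : covers f A B ->
  (forall u v, u \in A -> v \in B -> f u v -> g u v) -> covers g A B.
Proof.
move=> [a b] fg; split=> [u uA|v vB].
  by have [v vB fuv] := a _ uA; exists v => //; apply: fg.
by have [u uA fuv] := b _ vB; exists u => //; apply: fg.
Qed.

Lemma event_rel_psi f g C D E F :
  event_rel f E F -> ev E `<=` psi C -> ev F `<=` psi D ->
  (forall u v, u \in psi C -> v \in psi D -> f u v -> g u v) -> event_rel g E F.
Proof.
move=> EF /fsubsetP EC /fsubsetP FD fg; apply: event_rel_mono EF _ => u v uE vF.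
by apply: fg; [apply: EC|apply: FD].
Qed.

(** The only events that a step can add are [x] and [y], and both extensions relate them to each
    other alone. *)
Lemma bind_psi f g x y C D C' D' :
  psi C' `<=` x |` psi C -> psi D' `<=` y |` psi D ->
  (forall u v, u \in psi C -> v \in psi D -> f u v -> g u v) ->
  forall u v, u \in psi C' -> v \in psi D' -> bind f x y u v -> bind g x y u v.
Proof.
move=> /fsubsetP CC /fsubsetP DD fg u v /CC + /DD; rewrite !inE.
move=> uC vD [[fuv ux vy]|]; last by right.
by left; split=> //; apply: fg fuv; [rewrite (negPf ux) in uC|rewrite (negPf vy) in vD].
Qed.

(** The outer [f] only has to contain the composite of [g] and [h] on free events, while [g] and [h]
    are kept one-to-one so that the two simulations apply. *)
Definition comp (V W : indexed_rel) f C D : Prop :=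
  exists M g h, [/\ one_to_one g, one_to_one h, V g C M, W h M D
    & forall u v w, u \in psi C -> w \in psi D -> g u v -> h v w -> f u w].

Lemma simulation_comp V W : simulation dur i get V -> simulation dur i get W ->
  simulation dur i get (comp V W).
Proof.
move=> simV simW f C D f11 [M [g [h [g11 h11 CM MD ghf]]]].
have [[c1 c2] actV timeV] := simV _ _ _ g11 CM.
have [[d1 d2] actW timeW] := simW _ _ _ h11 MD.
split.
- split=> [u uC|w wD].
    have [v vM guv] := c1 _ uC; have [w wD hvw] := d1 _ vM.
    by exists w => //; apply: ghf guv hvw.
  have [v vM hvw] := d2 _ wD; have [u uC guv] := c2 _ vM.
  by exists u => //; apply: ghf guv hvw.
- move=> E l x C' CC'.
  have [G p M' MM' [EG GE] CM'] := actV _ _ _ _ CC'.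
  have [F y D' DD' [GF FG] MD'] := actW _ _ _ _ MM'.
  have [EC /fsubsetP C'C] := astep_psi CC'; have [FD /fsubsetP D'D] := astep_psi DD'.
  apply: ActionMatch DD' _ _.
    apply: (@event_rel_psi (fun u w => exists2 v, g u v & h v w) f C D) => //.
      split=> u b t.
        move=> /EG[v guv /GF[w hvw wF]]; exists w => //; by exists v.
      by move=> /FG[v guv /GE[w hvw wF]]; exists w => //; exists v.
    by move=> u w uC wD [v guv hvw]; apply: ghf guv hvw.
  exists M', (bind g x p), (bind h p y); split=> //; try exact: one_to_one_bind.
  (* The new events [x] and [y] are linked through [p]; the mixed cases contradict the shadowing of
     [p]. *)
  move=> u v w /C'C + /D'D + [[guv ux vp]|[-> ->]] [[hvw vp' wy]|[vp' ->]].
  + rewrite !inE (negPf ux) (negPf wy) /= => uC wD.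
    by left; split=> //; apply: ghf guv hvw.
  + by rewrite vp' eqxx in vp.
  + by rewrite eqxx in vp'.
  + by right.
- move=> d C' CC'; have [M' MM' CM'] := timeV _ _ CC'.
  have [D' DD' MD'] := timeW _ _ MM'; exists D' => //.
  exists M', g, h; split=> //.
  by rewrite (tstep_psi CC') (tstep_psi DD').
Qed.

Lemma bisimulating_comp V W :
  bisimulating V -> bisimulating W -> bisimulating (comp V W).
Proof.
move=> [simV simV'] [simW simW']; split; first exact: simulation_comp.
apply: eq_simulation (simulation_comp simW' simV') => f C D.
split=> -[M [g [h [g11 h11 CM MD ghf]]]]; exists M, (converse h), (converse g);
  split=> //; try exact: one_to_one_converse.
  by move=> u v w uD wC huv gvw; apply: ghf gvw huv.
by move=> u v w uD wC huv gvw; apply: ghf gvw huv.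
Qed.

(** * Bisimilarity with explicit correspondences, and its stability under renaming *)

(** The union of all bisimulating relations at one-to-one correspondences, closed so as to be
    monotone in [f]. *)
Definition bisim f C D : Prop :=
  exists V g, [/\ bisimulating V, one_to_one g, V g C D
    & forall u v, u \in psi C -> v \in psi D -> g u v -> f u v].

Lemma bisim_sym f C D : bisim f C D -> bisim (converse f) D C.
Proof.
move=> [V [g [/bisimulating_flip bV g11 CD gf]]]; exists (flip V), (converse g).
by split=> // [|u v uD vC]; [apply: one_to_one_converse|apply: gf].
Qed.

Lemma simulation_bisim : simulation dur i get bisim.
Proof.
move=> f C D f11 [V [g [bV g11 CD gf]]]; have [simV _] := bV.
have [cov actV timeV] := simV _ _ _ g11 CD; split.
- exact: covers_mono cov gf.
- move=> E l x C' CC'; have [F y D' DD' EF CD'] := actV _ _ _ _ CC'.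
  have [EC C'C] := astep_psi CC'; have [FD D'D] := astep_psi DD'.
  apply: ActionMatch DD' (event_rel_psi EF EC FD gf) _.
  exists V, (bind g x y); split=> //; first exact: one_to_one_bind.
  exact: bind_psi C'C D'D gf.
- move=> d C' CC'; have [D' DD' CD'] := timeV _ _ CC'; exists D' => //.
  by exists V, g; split=> //; rewrite (tstep_psi CC') (tstep_psi DD').
Qed.

Lemma bisimulating_bisim : bisimulating bisim.
Proof.
split; first exact: simulation_bisim.
apply: eq_simulation simulation_bisim => f C D; split; first exact: bisim_sym.
exact: (@bisim_sym (converse f)).
Qed.

Definition iso : indexed_rel := alpha (fun _ _ _ => False).

Lemma bisimulating_iso : bisimulating iso.
Proof. by apply: bisimulating_alpha; split. Qed.

(** Obtained by renaming the left side of reflexivity. The graph of the renaming is cut down to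
    [psi C], where it is injective. *)
Lemma iso_rename z y C : z \notin names C ->
  iso (fun w u => u \in psi C /\ w = subst z y u) (rename z y C) C.
Proof.
move=> zC; apply: alpha_rename zC _ => //; first exact: alpha_refl.
by move=> u v uC _ <-.
Qed.

(** The renamed configuration is alpha-equivalent to [C] along the graph of the renaming, and [C] is
    related to [D]; the composite is bisimulating. *)
Lemma renaming_closed_bisim : renaming_closed bisim.
Proof.
move=> f g C D z y [V [f' [bV f11 CD f'f]]] zC fg.
exists (comp iso V), (fun w v => exists2 u, u \in psi C /\ w = subst z y u & f' u v).
have zu u : u \in psi C -> z <> u by move=> + zu; rewrite -zu (negPf (notin_psi zC)).
(* The renaming could only identify [y] with [z], and [z] is not in [psi C]. *)
have one : one_to_one (fun w u => u \in psi C /\ w = subst z y u).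
  split=> [w u u' [uC ->] [u'C]|w w' u [_ ->] [_ ->] //].
  rewrite /subst; case: (u =P y) => [->|_]; case: (u' =P y) => [->|_] //.
    by move/(zu _ u'C).
  by move/esym/(zu _ uC).
split.
- exact: bisimulating_comp bisimulating_iso bV.
- have [one1 one2] := one; have [f1 f2] := f11; split.
    move=> w v v' [u uw f'uv] [u' u'w f'uv'].
    by apply: f1 f'uv _; rewrite (one1 _ _ _ uw u'w).
  move=> w w' v [u uw f'uv] [u' u'w f'uv'].
  by apply: one2 uw _; rewrite (f2 _ _ _ f'uv f'uv').
- exists C, (fun w u => u \in psi C /\ w = subst z y u), f'; split=> //.
    exact: iso_rename.
  by move=> w u v _ _ uw f'uv; exists u.
- by move=> w v _ vD [u [uC ->] f'uv]; apply: fg => //; apply: f'f.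
Qed.

Lemma equivariant_bisim : equivariant bisim.
Proof.
have mono : monotone bisim.
  move=> f g C D [V [f' [bV f11 CD f'f]]] fg; exists V, f'.
  by split=> // u v uC vD f'uv; apply: fg => //; apply: f'f.
split=> //; first exact: renaming_closed_bisim.
move=> f g C D z y /bisim_sym CD zC fg; apply: bisim_sym.
exact: renaming_closed_bisim CD zC fg.
Qed.

(** The refined configurations are related by [alpha bisim], through the alternative that it offers
    below a refinement. *)
Lemma bisim_CRefine a P f C D :
  one_to_one f -> bisim f C D -> bisim f (CRefine a P C) (CRefine a P D).
Proof.
move=> f11 CD; exists (alpha bisim), f; split=> //; last by split=> //; right.
exact: bisimulating_alpha equivariant_bisim bisimulating_bisim.
Qed.

(** * Agreement with the defined bisimilarity *)

(** A bisimulation yields correspondences built by [update], while a simulation asks for [bind];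
    closing upwards on free events absorbs the difference. *)
Definition weaken (S : config -> config -> corr -> Prop) f C D : Prop :=
  exists2 g, S C D g & forall u v, u \in psi C -> v \in psi D -> g u v -> f u v.

(** Causes are events of the configurations, so the bijection provides the partners whose existence
    [event_rel] demands. *)
Lemma same_causes_event_rel f C D E F : event_bijection f C D ->
  ev E `<=` psi C -> ev F `<=` psi D -> same_causes f E F -> event_rel f E F.
Proof.
move=> [_ _ cov1 cov2] /fsubsetP EC /fsubsetP FD EF; split=> u b t uE.
  have /cov1[v vD fuv] : u \in psi C by apply/EC/in_ev; exists b, t.
  by exists v => //; apply/(EF _ _ _ _ fuv).
have /cov2[v vD fuv] : u \in psi D by apply/FD/in_ev; exists b, t.
by exists v => //; apply/(EF _ _ _ _ fuv).
Qed.

Lemma event_rel_same_causes f E F :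
  one_to_one f -> event_rel f E F -> same_causes f E F.
Proof.
move=> [f1 f2] [EF FE] u v b t fuv; split=> [/EF[v' fuv']|/FE[u' fuv']].
  by rewrite (f1 _ _ _ fuv' fuv).
by rewrite (f2 _ _ _ fuv' fuv).
Qed.

Lemma bisimulating_weaken S :
  bisimulation dur i get S -> bisimulating (weaken S).
Proof.
move=> bS; split=> [f C D|f D C] f11 [g /bS[] bij actC actD timeC timeD gf].
- have [_ _ cov1 cov2] := bij; split.
  + exact: (@covers_mono g).
  + move=> E l x C' CC'; have [F [y [D' [DD' EF CD']]]] := actC _ _ _ _ CC'.
    have [EC C'C] := astep_psi CC'; have [FD D'D] := astep_psi DD'.
    apply: ActionMatch DD' _ _.
      exact: event_rel_psi (same_causes_event_rel bij EC FD EF) EC FD gf.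
    exists (update g C' D' x y) => // u v uC vD.
    move=> [[guv]|[-> ->]]; last by right.
    rewrite !inE => /andP[ux _] /andP[vy _].
    by apply: (bind_psi C'C D'D gf) => //; left.
  + move=> d C' CC'; have [D' DD' CD'] := timeC _ _ CC'; exists D' => //.
    by exists g => //; rewrite (tstep_psi CC') (tstep_psi DD').
- have [_ _ cov1 cov2] := bij; split.
  + by apply: (@covers_mono (converse g)) => // u v uC vD; apply: gf.
  + move=> F l y D' DD'; have [E [x [C' [CC' EF CD']]]] := actD _ _ _ _ DD'.
    have [EC C'C] := astep_psi CC'; have [FD D'D] := astep_psi DD'.
    apply: ActionMatch CC' _ _.
      have [] := event_rel_psi (same_causes_event_rel bij EC FD EF) EC FD gf.
      by split.
    exists (update g C' D' x y) => // u v uC vD.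
    move=> [[guv]|[-> ->]]; last by right.
    rewrite !inE => /andP[ux _] /andP[vy _].
    by apply/bind_converse; apply: (bind_psi C'C D'D gf) => //; left.
  + move=> d D' DD'; have [C' CC' CD'] := timeD _ _ DD'; exists C' => //.
    by exists g => //; rewrite (tstep_psi CC') (tstep_psi DD').
Qed.

Lemma one_to_one_update f C D x y : one_to_one f -> one_to_one (update f C D x y).
Proof.
have sub u v : update f C D x y u v -> bind f x y u v.
  by move=> [[fuv]|]; [rewrite !inE => /andP[ux _] /andP[vy _]; left|right].
move=> /(one_to_one_bind x y)[b1 b2].
by split=> [u v v' /sub fv /sub fv'|u u' v /sub fv /sub fv'];
  [apply: b1 fv fv'|apply: b2 fv fv'].
Qed.

Lemma bisimulation_bisim :
  bisimulation dur i get (fun C D f => one_to_one f /\ bisim f C D).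
Proof.
move=> C D f [f11 CD].
have [cov actC timeC] := simulation_bisim f11 CD.
have [_ actD timeD] := simulation_bisim (one_to_one_converse f11) (bisim_sym CD).
have [mono _ _] := equivariant_bisim; have [f1 f2] := f11; have [cov1 cov2] := cov.
split.
- by split.
- move=> E l x C' /actC[F y D' DD' EF CD']; exists F, y, D'; split=> //.
    exact: event_rel_same_causes.
  split; first exact: one_to_one_update.
  (* On events of [C'] and [D'], the restriction imposed by [update] is automatic. *)
  apply: mono CD' _ => u v uC vD [[fuv ux vy]|]; last by right.
  by left; rewrite !inE ux vy.
- move=> F l y D' /actD[E x C' CC' [FE EF] /bisim_sym CD']; exists E, x, C'; split=> //.
    exact: event_rel_same_causes.
  split; first exact: one_to_one_update.
  apply: mono CD' _ => u v uC vD [[fuv ux vy]|[]]; last by right.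
  by left; rewrite !inE ux vy.
- by move=> d C' /timeC[D' DD' CD']; exists D'.
- by move=> d D' /timeD[C' CC' /bisim_sym CD']; exists C'.
Qed.

Lemma bisimilarP C D : bisimilar dur i get C D <-> exists2 f, one_to_one f & bisim f C D.
Proof.
split=> [[S [f [bS CD]]]|[f f11 CD]]; last first.
  by exists (fun C D f => one_to_one f /\ bisim f C D), f; split=> //;
    apply: bisimulation_bisim.
have [[f1 f2 _ _] _ _ _ _] := bS _ _ _ CD.
exists f => //; exists (weaken S), f; split=> //; first exact: bisimulating_weaken.
by exists f.
Qed.

End Steps.

End Refinement.

Theorem theorem7p2 (R : realDomainType) (act event : choiceType)
    (dur : option act -> time R) (i : act)
    (get : (event -> Prop) -> event)
    (event_infinite : forall s : seq event, exists x, x \notin s)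
    (get_in : forall S : event -> Prop, (exists x, S x) -> S (get S))
    (P Q : config R act event) (a : act) (E : proc R act) :
  bisimilar dur i get P Q ->
  bisimilar dur i get (CRefine a E P) (CRefine a E Q).
Proof.
move=> /(bisimilarP _ _ _ event_infinite)[f f11 PQ].
apply/(bisimilarP _ _ _ event_infinite).
by exists f => //; apply: bisim_CRefine.
Qed.
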